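(* For $n\ge 1$ let $$G_n(t,z)=\sum_{i=0}^{\infty}\sum_{j=0}^{\infty}g_{i,j}\,z^i t^j,$$ where $g_{i,j}$ (depending on $n$) is the number of Dyck paths of semilength $i+1$ with exactly $j$ high peaks at height $n$. Then $$G_1(t,z)=\frac{1+z\,C(z)^2}{1-tz-tz^2C(z)^2},$$ and for all $n\ge 2$ $$G_n(t,z)=\frac{G_1(t,z)\,z\,U\!\left(n-4,\tfrac{1}{2\sqrt z}\right)-U\!\left(n-2,\tfrac{1}{2\sqrt z}\right)}{G_1(t,z)\,z^2\,U\!\left(n-2,\tfrac{1}{2\sqrt z}\right)-z\,U\!\left(n,\tfrac{1}{2\sqrt z}\right)}.$$
   Context: A Dyck path of semilength $m$ is a lattice path in the first quadrant (never going below the $x$-axis) from $(0,0)$ to $(2m,0)$ using up steps $u=(1,1)$ and down steps $d=(1,-1)$. A peak is an occurrence of an up step immediately followed by a down step; the height of the peak is the height ($y$-coordinate) of the starting point of its $u$ step. A high peak is a peak of height at least $1$. The Catalan generating function is $C(z)=\sum_{n\ge0}\frac{1}{n+1}\binom{2n}{n}z^n=\frac{1-\sqrt{1-4z}}{2z}$, satisfying $C(z)=1+zC(z)^2$. $U(m,s)$ denotes the Chebyshev polynomial of the second kind, given by $U(0,s)=1$, $U(1,s)=2s$ and $U(m+1,s)=2s\,U(m,s)-U(m-1,s)$, extended by this recurrence to negative indices (so $U(-1,s)=0$, $U(-2,s)=-1$). *)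

(* Defs.v *)
From HB Require Import structures.
From mathcomp Require Import all_boot all_order all_algebra.
From mathcomp Require Import boolp.

Set Implicit Arguments.
Unset Strict Implicit.
Unset Printing Implicit Defensive.

Import Order.TTheory GRing.Theory Num.Theory.
Local Open Scope ring_scope.

(* Formal power series: [Fps a] is \sum_k a_k X^k.  The type is a record, and
   not an alias of [nat -> R], so that it does not get pointwise operations. *)
Record fps (R : Type) : Type := Fps { fps_coef :> nat -> R }.

HB.instance Definition _ (R : Type) := gen_eqMixin (fps R).
HB.instance Definition _ (R : Type) := gen_choiceMixin (fps R).

Lemma fpsP (R : Type) (f g : fps R) : (forall k, f k = g k) <-> f = g.
Proof.
split=> [|-> //]; case: f g => f [g] /= fg.
by congr Fps; apply: funext.
Qed.

Section Zmodule.
Variable R : zmodType.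
Implicit Types f g h : fps R.

Definition fps_zero : fps R := Fps (fun=> 0).
Definition fps_opp f : fps R := Fps (fun k => - f k).
Definition fps_add f g : fps R := Fps (fun k => f k + g k).

Fact fps_addA : associative fps_add.
Proof. by move=> f g h; apply/fpsP => k /=; rewrite addrA. Qed.
Fact fps_addC : commutative fps_add.
Proof. by move=> f g; apply/fpsP => k /=; rewrite addrC. Qed.
Fact fps_add0 : left_id fps_zero fps_add.
Proof. by move=> f; apply/fpsP => k /=; rewrite add0r. Qed.
Fact fps_addN : left_inverse fps_zero fps_opp fps_add.
Proof. by move=> f; apply/fpsP => k /=; rewrite addNr. Qed.

HB.instance Definition _ :=
  GRing.isZmodule.Build (fps R) fps_addA fps_addC fps_add0 fps_addN.

Lemma fps_coef0 k : (0 : fps R) k = 0. Proof. by []. Qed.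
Lemma fps_coefN f k : (- f) k = - f k. Proof. by []. Qed.
Lemma fps_coefD f g k : (f + g) k = f k + g k. Proof. by []. Qed.

End Zmodule.

Section Ring.
Variable R : comNzRingType.
Implicit Types f g h : fps R.

Definition fpsC (c : R) : fps R := Fps (fun k => c *+ (k == 0)%N).
Definition fpsX : fps R := Fps (fun k => (k == 1)%:R).
Definition fps_mul f g : fps R :=
  Fps (fun k => \sum_(i < k.+1) f i * g (k - i)%N).

Lemma fps_mul_rev f g k : fps_mul f g k = \sum_(i < k.+1) f (k - i)%N * g i.
Proof.
rewrite /= (reindex_inj rev_ord_inj) /=.
by apply: eq_bigr => j _; rewrite (sub_ordK j).
Qed.

Fact fps_mulA : associative fps_mul.
Proof.
move=> p q r; apply/fpsP=> i; rewrite [RHS]fps_mul_rev.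
pose coef3 j k := p j * (q (i - j - k)%N * r k).
transitivity (\sum_(j < i.+1) \sum_(k < i.+1 | (k <= i - j)%N) coef3 j k).
  apply: eq_bigr => j _; rewrite fps_mul_rev big_distrr /=.
  by rewrite (big_ord_narrow_leq (leq_subr _ _)).
rewrite (exchange_big_dep predT) //=; apply: eq_bigr => k _.
transitivity (\sum_(j < i.+1 | (j <= i - k)%N) coef3 j k).
  apply: eq_bigl => j; rewrite -ltnS -(ltnS j) -!subSn ?leq_ord //.
  by rewrite -subn_gt0 -(subn_gt0 j) -!subnDA addnC.
rewrite (big_ord_narrow_leq (leq_subr _ _)) big_distrl /=.
by apply: eq_bigr => j _; rewrite /coef3 -!subnDA addnC mulrA.
Qed.

Fact fps_mulC : commutative fps_mul.
Proof.
move=> f g; apply/fpsP => k; rewrite fps_mul_rev.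
by apply: eq_bigr => i _; rewrite mulrC.
Qed.

Fact fps_mul1 : left_id (fpsC 1) fps_mul.
Proof.
move=> f; apply/fpsP => k; rewrite /= big_ord_recl /= subn0 mul1r.
by rewrite big1 ?addr0 // => i _; rewrite mul0r.
Qed.

Fact fps_mulDl : left_distributive fps_mul +%R.
Proof.
move=> f g h; apply/fpsP => k /=; rewrite -big_split.
by apply: eq_bigr => i _; rewrite mulrDl.
Qed.

Fact fps_1neq0 : fpsC 1 != 0.
Proof. by apply/eqP => /fpsP/(_ 0); apply/eqP; exact: oner_neq0. Qed.

HB.instance Definition _ := GRing.Zmodule_isComNzRing.Build (fps R)
  fps_mulA fps_mulC fps_mul1 fps_mulDl fps_1neq0.

Lemma fps_coefM f g k : (f * g) k = \sum_(i < k.+1) f i * g (k - i)%N.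
Proof. by []. Qed.
Lemma fps_coef1 k : (1 : fps R) k = (k == 0)%:R. Proof. by []. Qed.

Lemma fps_coefXM f k : (fpsX * f) k = if k is k'.+1 then f k' else 0.
Proof.
rewrite fps_coefM big_ord_recl /= mul0r add0r.
case: k => [|k]; first by rewrite big_ord0.
rewrite big_ord_recl /= mul1r subSS subn0 big1 ?addr0 // => i _.
by rewrite mul0r.
Qed.

Definition fps_unit : {pred fps R} := fun f => `[< exists g, g * f = 1 >].
Definition fps_inv f : fps R :=
  if pselect (exists g, g * f = 1) is left fg then projT1 (cid fg) else f.

Fact fps_mulVx : {in fps_unit, left_inverse 1 fps_inv *%R}.
Proof.
move=> f /asboolP uf; rewrite /fps_inv.
by case: pselect => // fg; case: (cid fg).
Qed.
Fact fps_unitPl f g : g * f = 1 -> fps_unit f.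
Proof. by move=> gf; apply/asboolP; exists g. Qed.
Fact fps_inv_out : {in [predC fps_unit], fps_inv =1 id}.
Proof. by move=> f /asboolP nf; rewrite /fps_inv; case: pselect. Qed.

HB.instance Definition _ :=
  GRing.ComNzRing_hasMulInverse.Build (fps R) fps_mulVx fps_unitPl fps_inv_out.

(* The substitution X |-> X^2. *)
Definition fps_subst_sq f : fps R :=
  Fps (fun k => if odd k then 0 else f k./2).

Fact fps_subst_sq_zmod : zmod_morphism fps_subst_sq.
Proof.
by move=> f g; apply/fpsP => k /=; case: odd; rewrite ?fps_coefD //= subr0.
Qed.

Fact fps_subst_sq_monoid : monoid_morphism fps_subst_sq.
Proof.
split=> [|f g]; first by apply/fpsP => -[|[|k]] //=; case: odd.
apply/fpsP => k; rewrite fps_coefM /=.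
case: ifPn => [ok|/negbTE ek].
  rewrite big1 // => i _; case: ifPn => oi; first by rewrite mul0r.
  by rewrite oddB ?leq_ord // ok (negbTE oi) mulr0.
have [m -> {ek}] : exists m, k = m.*2.
  by exists k./2; rewrite -[LHS]odd_double_half ek.
apply/esym; rewrite doubleK -(big_mkord xpredT (fun i =>
  (if odd i then 0 else f i./2) *
  (if odd (m.*2 - i) then 0 else g (m.*2 - i)./2))) /=.
rewrite -(big_mkord xpredT (fun i => f i * g (m - i)%N)).
set F := BIG_F; transitivity (\sum_(0 <= i < m.+1) F i.*2); last first.
  by apply: eq_bigr => i _; rewrite /F -doubleB !odd_double !doubleK.
have: forall i, F i.*2.+1 = 0 by move=> i; rewrite /F /= odd_double mul0r.
move: F => F; elim: m => [|m IH] Fodd; first by rewrite !big_nat1.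
rewrite doubleS big_nat_recr //= big_nat_recr //= IH // Fodd addr0.
by rewrite [RHS]big_nat_recr.
Qed.

HB.instance Definition _ :=
  GRing.isZmodMorphism.Build (fps R) (fps R) fps_subst_sq fps_subst_sq_zmod.
HB.instance Definition _ :=
  GRing.isMonoidMorphism.Build (fps R) (fps R) fps_subst_sq
    fps_subst_sq_monoid.

Lemma fps_subst_sq_inj : injective fps_subst_sq.
Proof.
move=> f g /fpsP fg; apply/fpsP => k.
by have := fg k.*2; rewrite /= odd_double doubleK.
Qed.

Lemma fps_subst_sqX : fps_subst_sq fpsX = fpsX ^+ 2.
Proof.
apply/fpsP => k; rewrite expr2 fps_coefXM.
by case: k => [|[|[|[|k]]]] //=; case: odd.
Qed.

End Ring.

Section Domain.
Variable R : idomainType.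

Fact fps_integral : GRing.integral_domain_axiom (fps R).
Proof.
move=> f g fg0.
have low (h : fps R) : h != 0 ->
    exists2 n, h n != 0 & forall i, (i < n)%N -> h i = 0.
  move=> /eqP h0; have ex : exists n, h n != 0.
    apply: contrapT => nh; apply: h0; apply/fpsP => k.
    by apply/eqP; apply: contrapT => hk; apply: nh; exists k; apply/negP.
  exists (ex_minn ex); case: ex_minnP => // n _ min_n i lt_in.
  by apply/eqP; apply: contraTT lt_in => /min_n; rewrite -leqNgt.
apply/norP => -[/low[m fm f0] /low[n gn g0]].
have /fpsP/(_ (m + n)%N) := fg0; rewrite fps_coefM fps_coef0.
have lt_m : (m < (m + n).+1)%N by rewrite ltnS leq_addr.
rewrite (bigD1 (Ordinal lt_m)) //= addKn big1 ?addr0.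
  by apply/eqP; rewrite mulf_neq0.
move=> i; rewrite -val_eqE /= => ne_im.
have [/f0->|le_mi] := ltnP i m; first by rewrite mul0r.
rewrite g0 ?mulr0 // ltn_subLR; last by rewrite -ltnS ltn_ord.
by rewrite ltn_add2r ltn_neqAle eq_sym ne_im.
Qed.

HB.instance Definition _ :=
  GRing.ComUnitRing_isIntegral.Build (fps R) fps_integral.

End Domain.

Section Chebyshev.
Variables (R : comNzRingType) (s : R).

Fixpoint chebU_rec (a b : R) (k : nat) : R :=
  match k with
  | 0 => a
  | 1 => b
  | (k'.+1 as k1).+1 => 2 * s * chebU_rec a b k1 - chebU_rec a b k'
  end.

(* [Negz k] is - (k + 1): the recurrence read downwards has the same form, and
   starts from U(-1) = 0 and U(-2) = -1. *)
Definition chebU (m : int) : R :=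
  match m with
  | Posz k => chebU_rec 1 (2 * s) k
  | Negz k => chebU_rec 0 (- 1) k
  end.

Lemma chebU0 : chebU 0 = 1. Proof. by []. Qed.
Lemma chebU1 : chebU 1 = 2 * s. Proof. by []. Qed.
Lemma chebU_succ (m : int) : chebU (m + 1) = 2 * s * chebU m - chebU (m - 1).
Proof.
have UN k : chebU_rec 0 (- 1) k.+2 =
  2 * s * chebU_rec 0 (- 1) k.+1 - chebU_rec 0 (- 1) k by [].
have UP k : chebU_rec 1 (2 * s) k.+2 =
  2 * s * chebU_rec 1 (2 * s) k.+1 - chebU_rec 1 (2 * s) k by [].
case: m => [[|k]|[|[|k]]].
- by rewrite /= mulr1 subr0.
- have -> : Posz k.+1 + 1 = Posz k.+2 by rewrite -PoszD addn1.
  have -> : Posz k.+1 - 1 = Posz k by rewrite intS addrC addKr.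
  exact: UP.
- by rewrite /= mulr0 sub0r opprK.
- by rewrite /= subr0 subrr.
- have -> : Negz k.+2 + 1 = Negz k.+1.
    by rewrite !NegzE (intS k.+2) opprD addrAC addNr add0r.
  have -> : Negz k.+2 - 1 = Negz k.+3.
    by rewrite !NegzE (intS k.+3) opprD addrC.
  by rewrite /chebU (UN k.+1) opprB addrC subrK.
Qed.

End Chebyshev.

(* A path is its sequence of steps: [true] is u = (1,1), [false] is
   d = (1,-1).  [path_height p k] is the ordinate of its point of abscissa k. *)
Definition path_height (p : seq bool) (k : nat) : int :=
  (count_mem true (take k p))%:Z - (count_mem false (take k p))%:Z.

Definition is_dyck (m : nat) (p : seq bool) : bool :=
  [&& size p == m.*2,
      all (fun k => 0 <= path_height p k) (iota 0 m.*2.+1)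
    & path_height p m.*2 == 0].

(* A peak is designated by the abscissa k of the starting point of its u step;
   its height is [path_height p k]. *)
Definition is_peak (p : seq bool) (k : nat) : bool :=
  [&& (k.+1 < size p)%N, nth false p k == true & nth true p k.+1 == false].

Definition is_high_peak (p : seq bool) (k : nat) : bool :=
  is_peak p k && (1 <= path_height p k).

Definition num_high_peaks (n : nat) (p : seq bool) : nat :=
  count (fun k => is_high_peak p k && (path_height p k == n%:Z))
        (iota 0 (size p)).

Definition dyck_count (n i j : nat) : nat :=
  #|[set p : (i.+1.*2).-tuple bool |
      is_dyck i.+1 p & num_high_peaks n p == j]|.

(* Series in z (outer variable) whose coefficients are series in t. *)
Definition Gseries (n : nat) : fps (fps rat) :=
  Fps (fun i => Fps (fun j => (dyck_count n i j)%:R)).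

Definition Cseries : fps (fps rat) :=
  Fps (fun n => fpsC ('C(n.*2, n)%:R / n.+1%:R)).

(* The field in which the identities are read: the fraction field of
   Q[[t]][[w]], where w = sqrt z.  It contains Q[[t]][[z]] via z = w^2. *)
Definition K := {fraction fps (fps rat)}.

Definition of_zt (f : fps (fps rat)) : K := FracField.tofrac (fps_subst_sq f).

Definition sqrtz : K := FracField.tofrac (fpsX _).
Definition z : K := of_zt (fpsX _).
Definition t : K := of_zt (fpsC (fpsX _)).
Definition C : K := of_zt Cseries.
Definition G (n : nat) : K := of_zt (Gseries n).

Lemma sqr_sqrtz : sqrtz ^+ 2 = z.
Proof. by rewrite /z /of_zt fps_subst_sqX rmorphXn. Qed.

Definition U (m : int) (s : K) : K := chebU s m.

(* Main.v *)
Require Import Defs.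
From mathcomp Require Import all_boot all_order all_algebra.
From mathcomp Require Import ring zify.

Import GRing.Theory.
Local Open Scope ring_scope.

Set Implicit Arguments.
Unset Strict Implicit.
Unset Printing Implicit Defensive.

(** Cut a Dyck path at its first return to the ground: it is empty or of the
    form u a d b.  If Phi_n is the series of Dyck paths, empty one included,
    in which t marks the peaks at height n, then the peaks at height n + 1 of
    u a d b are the peaks at height n of a together with those at height n + 1
    of b, so Phi_(n+1) = 1 + z Phi_n Phi_(n+1) ([marked_dyckS]).  At height 0,
    u a d is a marked peak exactly when a is empty, which replaces Phi_n by
    C - 1 + t ([marked_dyck0]).

    The cut itself is never performed on words.  Paths that end on the ground
    are counted from every starting height at once, in powers of w = sqrt z,
    remembering only whether the preceding step was up.  Reading the first
    step gives a linear system that has a unique solution, since each unknown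
    occurs on the right multiplied by w ([first_step_unique]).  The product
    formula for first passage from height h + 1 to height 0 ([walks_markS],
    [walks_mark0]) and the closed form w^h C^(h+1) for unmarked paths
    ([walks_unmarked]) then follow by checking that both sides solve the same
    system.  On the side of binomial coefficients only C = 1 + z C^2 is
    required ([Cseries_eq]).

    As Phi_n = 1 + z G_n for n >= 1, the two relations give
    G_1 (1 - t z C) = C and the homographic recurrence
    G_(n+1) (1 - z (1 + z G_n)) = 1 + z G_n.  The Chebyshev polynomials
    linearise it: N_m = G_1 z U(m-2) - U(m), taken at 1 / (2 sqrt z), satisfies
    N_(m+1) = N_m / sqrt z - N_(m-1), and G_n = N_(n-2) / (z N_n)
    ([homographic_cheb]), which is the stated formula.  The induction also shows
    that N_n is nonzero, so that the quotient is meaningful. *)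

(** * Coefficients of formal power series *)

Section SeriesCoefficients.
Variable R : comNzRingType.
Implicit Types f : fps R.

Lemma fps_coefCM (c : R) f k : (fpsC c * f) k = c * f k.
Proof.
rewrite fps_coefM big_ord_recl /= subn0 big1 ?addr0 // => i _.
by rewrite mulr0n mul0r.
Qed.

Lemma fps_coefXn m k : (fpsX R ^+ m) k = (k == m)%:R.
Proof.
elim: m k => [|m IHm] k; first by rewrite expr0 fps_coef1.
by rewrite exprS fps_coefXM; case: k => [|k] //; rewrite IHm.
Qed.

Lemma fps_coef_sum (I : Type) (r : seq I) (P : pred I) (F : I -> fps R) k :
  (\sum_(i <- r | P i) F i) k = \sum_(i <- r | P i) F i k.
Proof. exact: (big_morph (fun f : fps R => f k)). Qed.

Lemma fpsC1 : fpsC (1 : R) = 1. Proof. by []. Qed.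

Lemma fps_coef_subst_sq f k :
  fps_subst_sq f k = if odd k then 0 else f k./2.
Proof. by []. Qed.

Lemma fps_subst_sqC (c : R) : fps_subst_sq (fpsC c) = fpsC c.
Proof. by apply/fpsP => -[|[|k]] //=; case: odd. Qed.

End SeriesCoefficients.

Lemma big_tuple_cons (T : finType) (V : nmodType) l (F : seq T -> V) :
  \sum_(p : l.+1.-tuple T) F p = \sum_(x : T) \sum_(q : l.-tuple T) F (x :: q).
Proof.
rewrite (pair_big xpredT xpredT (fun x (q : l.-tuple T) => F (x :: q))) /=.
rewrite (reindex (fun xq : T * l.-tuple T => [tuple of xq.1 :: xq.2])) //=.
exists (fun p : l.+1.-tuple T => (thead p, [tuple of behead p])) => [[x q] _|p _].
  by congr pair; apply: val_inj.
by rewrite [RHS]tuple_eta.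
Qed.

(** * Weighted paths to the ground and the first-step system *)

Section WeightedPaths.
Variable R : comNzRingType.
Implicit Types (wt : nat -> bool -> R) (h : nat) (b : bool).

(** The weight of the paths from height [h] to the ground, [b] telling whether
    the step preceding them is up.  A peak is recognised at its down step, so
    only down steps carry a factor [wt h b]; paths that cross the ground, or
    end above it, weigh 0. *)
Fixpoint path_weight wt h b (p : seq bool) : R :=
  match p with
  | [::] => (h == 0)%:R
  | true :: q => path_weight wt h.+1 true q
  | false :: q => if h is h'.+1 then wt h b * path_weight wt h' false q else 0
  end.

Definition walks wt h b : fps R :=
  Fps (fun l => \sum_(p : l.-tuple bool) path_weight wt h b p).

(** The first-step operator on families of series indexed by a height and a
    flag; an arbitrary [source] is allowed so that a family shifted down by
    one level fits as well: the source then stands for the steps into the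
    level that the shift removes. *)
Definition first_step wt (source B : nat -> bool -> fps R) h b : fps R :=
  source h b + fpsX R * B h.+1 true
  + (if h is h'.+1 then fpsC (wt h b) * (fpsX R * B h' false) else 0).

Definition ends_here h b : fps R := (h == 0)%:R.

Lemma walks_coefS wt h b l :
  walks wt h b l.+1 = walks wt h.+1 true l
    + (if h is h'.+1 then wt h b * walks wt h' false l else 0).
Proof.
rewrite /= big_tuple_cons big_bool /=; congr (_ + _).
case: h => [|h]; first by rewrite big1.
by rewrite big_distrr.
Qed.

Lemma walks_coef0 wt h b : walks wt h b 0 = (h == 0)%:R.
Proof.
rewrite /= (big_pred1 [tuple]) // => p; apply/esym/eqP.
exact: tuple0.
Qed.

Lemma walks_first_step wt h b :
  walks wt h b = first_step wt ends_here (walks wt) h b.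
Proof.
have end_coef k : ends_here h b k = ((h == 0) && (k == 0))%:R.
  by rewrite /ends_here; case: eqP => _ //=.
apply/fpsP => -[|l]; rewrite /first_step !fps_coefD end_coef fps_coefXM.
  rewrite walks_coef0 andbT addr0.
  by case: h {end_coef} => [|h]; rewrite ?addr0 // fps_coefCM fps_coefXM mulr0 addr0.
rewrite walks_coefS andbF add0r; congr (_ + _).
by case: h {end_coef} => [|h] //; rewrite fps_coefCM fps_coefXM.
Qed.

(** Both unknowns on the right-hand side come with a factor X, so the system
    determines the coefficients one degree after the other. *)
Lemma first_step_unique wt source (B B' : nat -> bool -> fps R) :
    (forall h b, B h b = first_step wt source B h b) ->
    (forall h b, B' h b = first_step wt source B' h b) ->
  forall h b, B h b = B' h b.
Proof.
move=> eqB eqB' h b; apply/fpsP => l.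
elim: l h b => [|l IHl] h b; rewrite eqB eqB' /first_step !fps_coefD !fps_coefXM.
  by case: h => [|h] //; rewrite !fps_coefCM !fps_coefXM.
by rewrite IHl; case: h => [|h] //; rewrite !fps_coefCM !fps_coefXM IHl.
Qed.

Lemma walks_odd wt h b l : odd (l + h) -> walks wt h b l = 0.
Proof.
elim: l h b => [|l IHl] h b odd_lh.
  by rewrite walks_coef0; case: h odd_lh.
rewrite walks_coefS IHl ?addnS // add0r.
case: h odd_lh => [|h] // odd_lh; rewrite IHl ?mulr0 //.
by move: odd_lh; rewrite addSn addnS /= negbK.
Qed.

Lemma walks0_prev wt b b' : walks wt 0 b = walks wt 0 b'.
Proof. by rewrite walks_first_step [RHS]walks_first_step. Qed.

End WeightedPaths.

(** * Generating functions by first passage *)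

Section Marking.
Variables (R : comNzRingType) (t : R).
Local Notation X := (fpsX R).

Definition unmarked (h : nat) (b : bool) : R := 1.

(** A peak at height [n] has its down step start at height [n.+1]. *)
Definition mark (n h : nat) (b : bool) : R :=
  if b && (h == n.+1) then t else 1.

Definition marked_dyck n : fps R := walks (mark n) 0 false.

(** To descend from height [h] to the ground is to make [h] first passages to
    the next lower level, each preceded by an excursion counted by [c]. *)
Lemma walks_unmarked (c : fps R) h b :
  c = 1 + X ^+ 2 * c ^+ 2 -> walks unmarked h b = X ^+ h * c ^+ h.+1.
Proof.
move=> eq_c; move: h b.
apply: first_step_unique (walks_first_step unmarked) _ => -[|h] b.
  rewrite /first_step /ends_here {1}eq_c /=; ring.
rewrite /first_step /ends_here /= fpsC1.
rewrite (exprSr c h.+1) mulrA {2}eq_c !exprS; ring.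
Qed.

(** First passage to the ground: until then the path never sees the bottom
    level, so it is a path from [h] whose marked height has dropped by one.
    The last down step starts at height 1, not at the marked [n.+2]. *)
Lemma walks_markS n h b :
  walks (mark n.+1) h.+1 b = X * walks (mark n) h b * marked_dyck n.+1.
Proof.
pose source (h : nat) (b : bool) := X * marked_dyck n.+1 *+ (h == 0).
move: h b; apply: (first_step_unique (wt := mark n) (source := source)) => h b.
  rewrite {1}walks_first_step /first_step /source /ends_here /=.
  case: h => [|h] /=; last by rewrite /mark eqSS mulr0n.
  rewrite /mark andbF fpsC1 /marked_dyck; ring.
rewrite {1}walks_first_step /first_step /source /ends_here.
by case: h => [|h] /=; ring.
Qed.

(** First passage when the down steps from height 1 are the marked ones: the
    part above level 1 is unmarked, and the passage closes a peak only if
    that part is empty and follows an up step, hence the correction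
    [fpsC t - 1]. *)
Lemma walks_mark0 h b :
  walks (mark 0) h.+1 b =
    X * (walks unmarked h b + (fpsC t - 1) *+ (b && (h == 0))) * marked_dyck 0.
Proof.
pose source (h : nat) (b : bool) :=
  X * (if b then fpsC t else 1) * marked_dyck 0 *+ (h == 0).
move: h b; apply: (first_step_unique (wt := unmarked) (source := source)) => h b.
  rewrite {1}walks_first_step /first_step /source /ends_here /=.
  case: h => [|h] /=; last by rewrite /mark andbF mulr0n.
  by rewrite /mark /marked_dyck andbT; case: b; rewrite ?fpsC1; ring.
rewrite {1}walks_first_step /first_step /source /ends_here.
by case: h b => [|h] [] /=; rewrite ?andbF /=; ring.
Qed.

Lemma marked_dyckS n :
  marked_dyck n.+1 = 1 + X ^+ 2 * marked_dyck n * marked_dyck n.+1.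
Proof.
rewrite {1}/marked_dyck walks_first_step /first_step /ends_here /=.
rewrite walks_markS (walks0_prev _ true false) -/(marked_dyck n); ring.
Qed.

Lemma marked_dyck0 (c : fps R) : c = 1 + X ^+ 2 * c ^+ 2 ->
  marked_dyck 0 = 1 + X ^+ 2 * (c - 1 + fpsC t) * marked_dyck 0.
Proof.
move=> eq_c; rewrite {1}/marked_dyck walks_first_step /first_step /ends_here /=.
rewrite walks_mark0 (walks_unmarked _ _ eq_c) /=; ring.
Qed.

End Marking.

(** * Reading Dyck paths and peaks step by step *)

Definition step_height (x : bool) : int := if x then 1 else -1.

Lemma path_height_cons x p k :
  path_height (x :: p) k.+1 = step_height x + path_height p k.
Proof. by rewrite /path_height /=; case: x => /=; rewrite ?add0n PoszD; ring. Qed.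

Lemma path_height0 p : path_height p 0 = 0.
Proof. by rewrite /path_height take0. Qed.

Definition stays_nonneg (h : int) (p : seq bool) : bool :=
  all (fun k => 0 <= h + path_height p k) (iota 0 (size p).+1)
  && (h + path_height p (size p) == 0).

Definition num_peaks_from (n : nat) (h : int) (p : seq bool) : nat :=
  count (fun k => is_peak p k && (h + path_height p k == n%:Z)) (iota 0 (size p)).

(** A peak at the first step of a path can only be told by looking one step
    ahead, whereas [path_weight] looks one step back. *)
Definition starts_down (p : seq bool) : bool := ohead p == Some false.

Lemma stays_nonneg_cons (h : int) x p :
  stays_nonneg h (x :: p) = (0 <= h) && stays_nonneg (h + step_height x) p.
Proof.
rewrite /stays_nonneg -[iota 0 (size (x :: p)).+1]/(0%N :: iota (1 + 0) (size p).+1).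
rewrite iotaDl -[0%N :: _]cat1s all_cat all_seq1 all_map path_height0 addr0 -andbA.
rewrite [size (x :: p)]/= path_height_cons addrA; congr [&& _, _ & _].
by apply: eq_all => k; rewrite [LHS]/= path_height_cons addrA.
Qed.

Lemma num_peaks_from_cons n (h : int) x p :
  num_peaks_from n h (x :: p) =
    ([&& x, starts_down p & h == n%:Z] + num_peaks_from n (h + step_height x) p)%N.
Proof.
rewrite /num_peaks_from /= -[1%N]addn0 iotaDl count_map path_height0 addr0.
congr (_ + _)%N; last first.
  by apply: eq_count => k /=; rewrite path_height_cons addrA.
by rewrite /is_peak /starts_down; case: p x => [|[] p] [].
Qed.

(** The two ways of detecting peaks differ by the peak that the preceding up
    step may form with the head of [p]. *)
Lemma path_weight_mark n h b p :
  path_weight (mark (fpsX rat) n) h b p =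
  fpsX rat ^+ ([&& b, h == n.+1 & starts_down p] + num_peaks_from n h p)
    *+ stays_nonneg h p.
Proof.
elim: p h b => [|x p IHp] h b.
  rewrite /= !andbF /stays_nonneg /= path_height0 addr0.
  by case: h => [|h]; rewrite ?mulr1n ?mulr0n.
rewrite stays_nonneg_cons num_peaks_from_cons lez_nat /=.
case: x; rewrite {2}/starts_down /=.
  rewrite IHp !andbF add0n -PoszD addn1 eqSS eqz_nat.
  by rewrite [in RHS]andbC.
case: h => [|h].
  (* A down step from the ground leads to height -1. *)
  suff -> : stays_nonneg (0%:Z + step_height false) p = false by [].
  by rewrite /stays_nonneg /= path_height0.
have -> : h.+1%:Z + step_height false = h by rewrite /step_height intS; ring.
rewrite IHp /= add0n andbT mulrnAr; congr (_ *+ _).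
by rewrite /mark; case: andP => _; rewrite ?mul1r ?add1n ?exprS.
Qed.

Lemma is_dyckE m p :
  is_dyck m p = (size p == m.*2) && stays_nonneg 0 p.
Proof.
rewrite /is_dyck /stays_nonneg add0r; case: eqP => // ->.
rewrite !andTb; congr (_ && _).
by apply: eq_all => k; rewrite add0r.
Qed.

Lemma num_high_peaksE n p : num_high_peaks n.+1 p = num_peaks_from n.+1 0 p.
Proof.
apply: eq_count => k /=; rewrite add0r /is_high_peak -andbA.
by case: eqP => [->|]; rewrite ?andbF.
Qed.

Lemma dyck_count_walks n i j :
  (dyck_count n.+1 i j)%:R = marked_dyck (fpsX rat) n.+1 i.+1.*2 j.
Proof.
rewrite /marked_dyck /= fps_coef_sum /dyck_count -sum1_card natr_sum.
rewrite big_mkcond /=; apply: eq_bigr => p _.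
rewrite inE is_dyckE size_tuple eqxx path_weight_mark add0n num_high_peaksE.
case: stays_nonneg => //=.
by rewrite mulr1n fps_coefXn eq_sym; case: eqP.
Qed.

(** The coefficient of z^i in [Gseries] counts semilength i + 1: the factor z,
    which reads X^2 here, and the empty path account for the shift. *)
Lemma Gseries_walks n :
  1 + fpsX _ ^+ 2 * fps_subst_sq (Gseries n.+1) = marked_dyck (fpsX rat) n.+1.
Proof.
rewrite -fps_subst_sqX -rmorphM -[1](rmorph1 (@fps_subst_sq _)) -rmorphD.
apply/fpsP => k; rewrite fps_coef_subst_sq; case: ifPn => [odd_k|even_k].
  by rewrite /marked_dyck walks_odd // addn0.
have -> : k = k./2.*2 by rewrite -[LHS]odd_double_half (negbTE even_k).
rewrite doubleK fps_coefD fps_coefXM; case: k./2 => [|i].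
  by rewrite /marked_dyck walks_coef0 addr0.
by apply/fpsP => j; rewrite fps_coef1 add0r [LHS]dyck_count_walks.
Qed.

(** * The quadratic equation of the Catalan series *)

Definition catalan (n : nat) : rat := 'C(n.*2, n)%:R / n.+1%:R.

Lemma catalanS n : n.+2%:R * catalan n.+1 = (4 * n + 2)%:R * catalan n.
Proof.
have binS : (n.+1 * 'C(n.+1.*2, n.+1) = (4 * n + 2) * 'C(n.*2, n))%N.
  have down : (n.*2.+1 * 'C(n.*2, n) = n.+1 * 'C(n.*2.+1, n))%N.
    by rewrite (mul_bin_down n.*2.+1 n); congr (_ * _)%N; lia.
  rewrite -mul_bin_diag doubleS /= -doubleS -mul2n -mulnA -down.
  by rewrite mulnA; congr (_ * _)%N; lia.
rewrite /catalan [LHS]mulrC divfK ?Num.Theory.pnatr_eq0 //.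
by rewrite mulrA -natrM -binS natrM mulrAC mulfV ?mul1r ?Num.Theory.pnatr_eq0.
Qed.

(** With T_n the convolution, the symmetry of T_n under i |-> n - i gives
    2 \sum_i (i + 1) c_i c_(n-i) = (n + 2) T_n.  Splitting off the first term
    of this sum for n + 1 and lowering the index of the others by
    (i + 2) c_(i+1) = (4 i + 2) c_i yields
    (n + 3) / 2 T_(n+1) = c_(n+1) + (2 n + 2) T_n, whence T_n = c_(n+1) by
    induction, from the same two-term recurrence. *)
Lemma catalan_conv n :
  \sum_(i < n.+1) catalan i * catalan (n - i)%N = catalan n.+1.
Proof.
pose T n := \sum_(i < n.+1) catalan i * catalan (n - i)%N.
have sym k : \sum_(i < k.+1) i.+1%:R * (catalan i * catalan (k - i)%N)
    = k.+2%:R / 2 * T k.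
  set S := LHS; suff: S + S = k.+2%:R * T k by move=> SS; field: SS.
  rewrite {2}/S (reindex_inj rev_ord_inj) /= -big_split /T big_distrr /=.
  apply: eq_bigr => i _; rewrite subSS (subKn (ltn_ord i : (i <= k)%N)).
  rewrite (mulrC (catalan (k - i))) -mulrDl -natrD; congr (_%:R * _).
  by have := ltn_ord i; lia.
elim: n => [|n IHn]; first by rewrite big_ord1.
have catalan0 : catalan 0 = 1 by [].
(* The summand with 4 i + 2 is written as 4 (i + 1) - 2 to apply [sym]. *)
have lower : \sum_(i < n.+1) (lift ord0 i).+1%:R
    * (catalan (lift ord0 i) * catalan (n.+1 - lift ord0 i)%N)
    = 4 * (n.+2%:R / 2 * T n) - 2 * T n.
  rewrite -sym !big_distrr -sumrB /=; apply: eq_bigr => i _.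
  rewrite /bump leq0n add1n subSS mulrA catalanS natrD natrM -natr1; ring.
have := sym n.+1; rewrite big_ord_recl lower catalan0 mul1r mul1r subn0.
rewrite (IHn : T n = _) => eqT.
apply: (mulfI (_ : n.+3%:R / 2 != 0)).
  by rewrite mulf_neq0 ?Num.Theory.pnatr_eq0.
rewrite -eqT [RHS]mulrAC catalanS natrD natrM -!natr1; by field.
Qed.

Lemma Cseries_eq : Cseries = 1 + fpsX _ * Cseries ^+ 2.
Proof.
apply/fpsP => k; rewrite fps_coefD fps_coefXM; case: k => [|k].
  by rewrite addr0 /Cseries /= divr1.
rewrite fps_coef1 add0r expr2 fps_coefM /Cseries /=; apply/fpsP => j.
rewrite fps_coef_sum; case: j => [|j].
  rewrite -[LHS]catalan_conv; apply: eq_bigr => i _.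
  by rewrite fps_coefCM.
rewrite big1 // => i _; rewrite fps_coefCM /=; exact: mulr0.
Qed.

(** * Solving the recurrence with Chebyshev polynomials *)

Section Homographic.
Variable F : fieldType.

(** Eliminating [a] gives g (1 - z c - z t) = 1; multiply by c and use
    c - z c^2 = 1. *)
Lemma first_level_solved (a g c t z : F) :
    a = 1 + z * (c - 1 + t) * a -> g = a * (1 + z * g) -> c = 1 + z * c ^+ 2 ->
  g = (1 + z * c ^+ 2) / (1 - t * z - t * z ^+ 2 * c ^+ 2).
Proof.
move=> aE gE cE.
have a_inv : (1 - z * (c - 1 + t)) * a = 1 by rewrite mulrBl mul1r {1}aE; ring.
have g_inv : g * (1 - z * c - z * t) = 1.
  have eqg : (1 - z * (c - 1 + t)) * g = 1 + z * g.
    by rewrite {1}gE mulrA a_inv mul1r.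
  transitivity ((1 - z * (c - 1 + t)) * g - z * g); first by ring.
  by rewrite eqg addrK.
have c_inv : c - z * c ^+ 2 = 1 by rewrite {1}cE; ring.
have g_mul : g * (1 - t * z * c) = c.
  transitivity (g * (c - z * c ^+ 2 - t * z * c)); first by rewrite c_inv.
  transitivity (c * (g * (1 - z * c - z * t))); first by ring.
  by rewrite g_inv mulr1.
have -> : 1 - t * z - t * z ^+ 2 * c ^+ 2 = 1 - t * z * (1 + z * c ^+ 2) by ring.
rewrite -cE -{1}g_mul mulfK //.
apply: contra_eq_neq g_mul => ->; rewrite mulr0 eq_sym.
by apply: contra_eq_neq cE => ->; rewrite expr0n mulr0 addr0 eq_sym oner_neq0.
Qed.

Lemma next_level_solved (g g' z : F) : z != 0 ->
    1 + z * g' = 1 + z * (1 + z * g) * (1 + z * g') ->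
  g' * (1 - z * (1 + z * g)) = 1 + z * g.
Proof.
move=> z0 eqg; apply: (mulfI z0); apply: (addrI 1).
transitivity (1 + z * g' - z * (1 + z * g) * (1 + z * g') + z * (1 + z * g)).
  by ring.
by rewrite {1}eqg; ring.
Qed.

(** With G_1 for [x], the numerator of the formula for G_m is
    [cheb_comb w x (m - 2)] and its denominator is [z * cheb_comb w x m]. *)
Definition cheb_comb (w x : F) (m : int) : F :=
  x * w ^+ 2 * chebU (1 / (2 * w)) (m - 2) - chebU (1 / (2 * w)) m.

Variable w : F.
Hypotheses (w0 : w != 0) (two0 : 2 != 0 :> F).

Lemma double_cheb_arg : 2 * (1 / (2 * w)) = w^-1.
Proof. by field; rewrite w0 two0. Qed.

Lemma cheb_comb_succ x m :
  cheb_comb w x (m + 1) = cheb_comb w x m / w - cheb_comb w x (m - 1).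
Proof.
rewrite /cheb_comb [m + 1 - 2]addrAC !chebU_succ double_cheb_arg.
rewrite -[m - 2 - 1]addrAC; ring.
Qed.

(** Let z = w^2 and N_m = [cheb_comb w (g 1) m].  Substituting
    g_n = N_(n-2) / (z N_n) into the recurrence gives g_(n+1) z N_(n+1) = N_(n-1), by two uses of the three-term relation
    on N.  If N_(n+1) vanished, so would N_(n-1), and then that relation would
    force N_n = 0.  At n = 1 the formula reads g_1 = g_1, because U(-1) = 0
    and U(-3) = - U(1). *)
Lemma homographic_cheb (g : nat -> F) :
    (forall n, g n.+2 * (1 - w ^+ 2 * (1 + w ^+ 2 * g n.+1))
               = 1 + w ^+ 2 * g n.+1) ->
  forall n, cheb_comb w (g 1) n.+1 != 0 /\
    g n.+1 = cheb_comb w (g 1) (n.+1%:Z - 2) / (w ^+ 2 * cheb_comb w (g 1) n.+1).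
Proof.
move=> g_succ; set N := cheb_comb w (g 1).
elim=> [|n [nz IHn]].
  have -> : N 1 = - w^-1.
    by rewrite /N /cheb_comb /= double_cheb_arg mulr0 add0r.
  have -> : N (1%:Z - 2) = - (g 1 * w ^+ 2 / w).
    by rewrite /N /cheb_comb /= double_cheb_arg; ring.
  split; first by rewrite oppr_eq0 invr_eq0.
  by field; rewrite w0 oppr_eq0 oner_neq0.
set c := N n.+1 in nz IHn *; set d := N n.+2.
set a := N (n.+1%:Z - 2) in IHn; set b := N _.
have cE : c = b / w - a.
  rewrite /c /b /a; have -> : n.+1%:Z = n.+2%:Z - 2 + 1 by lia.
  by rewrite /N cheb_comb_succ; congr (_ - cheb_comb _ _ _); lia.
have dE : d = c / w - b.
  rewrite /d /c /b; have -> : n.+2%:Z = n.+1%:Z + 1 by lia.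
  by rewrite /N cheb_comb_succ; congr (_ - cheb_comb _ _ _); lia.
have gE : 1 + w ^+ 2 * g n.+1 = b / (w * c).
  have bE : b = (c + a) * w by rewrite cE; field.
  by rewrite IHn bE; field; rewrite w0 nz.
have gd : g n.+2 * w ^+ 2 * d = b.
  have := g_succ n; rewrite gE => /(congr1 ( *%R^~ (w * c))) /=.
  by rewrite divfK ?mulf_neq0 // => <-; rewrite dE; field; rewrite w0 nz.
have d0 : d != 0.
  apply: contra_neq nz => d0.
  have b0 : b = 0 by rewrite -gd d0 mulr0.
  have /eqP := dE; rewrite d0 b0 subr0 eq_sym mulf_eq0 invr_eq0 (negbTE w0) orbF.
  by move/eqP.
by split=> //; rewrite -gd; field; rewrite d0 w0.
Qed.

Lemma homographic_solved (z : F) (g : nat -> F) : w ^+ 2 = z ->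
    (forall n, g n.+2 * (1 - z * (1 + z * g n.+1)) = 1 + z * g n.+1) ->
  forall n, g n.+1 =
    (g 1 * z * chebU (1 / (2 * w)) (n.+1%:Z - 4)
       - chebU (1 / (2 * w)) (n.+1%:Z - 2))
    / (g 1 * z ^+ 2 * chebU (1 / (2 * w)) (n.+1%:Z - 2)
       - z * chebU (1 / (2 * w)) n.+1%:Z).
Proof.
move=> <- g_succ n; rewrite (homographic_cheb g_succ n).2 /cheb_comb.
have -> : n.+1%:Z - 2 - 2 = n.+1%:Z - 4 by lia.
by congr (_ / _); ring.
Qed.

End Homographic.

(** * The recurrence in the fraction field *)

Definition dyck_frac n : K := FracField.tofrac (marked_dyck (fpsX rat) n).

Lemma C_eq : C = 1 + z * C ^+ 2.
Proof.
by rewrite /C /z /of_zt {1}Cseries_eq !(rmorphD, rmorphM, rmorphXn, rmorph1).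
Qed.

Lemma dyck_frac0 : dyck_frac 0 = 1 + z * (C - 1 + t) * dyck_frac 0.
Proof.
have eq_c : fps_subst_sq Cseries = 1 + fpsX _ ^+ 2 * fps_subst_sq Cseries ^+ 2.
  by rewrite {1}Cseries_eq -fps_subst_sqX -rmorphXn -rmorphM rmorphD rmorph1.
rewrite {1}/dyck_frac (marked_dyck0 _ eq_c).
rewrite /z /t /C /of_zt fps_subst_sqX fps_subst_sqC.
by rewrite !(rmorphD, rmorphM, rmorphXn, rmorph1, rmorphN).
Qed.

Lemma dyck_fracS n : dyck_frac n.+1 = 1 + z * dyck_frac n * dyck_frac n.+1.
Proof.
rewrite {1}/dyck_frac marked_dyckS -sqr_sqrtz /sqrtz.
by rewrite !(rmorphD, rmorphM, rmorphXn, rmorph1).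
Qed.

Lemma dyck_fracE n : dyck_frac n.+1 = 1 + z * G n.+1.
Proof.
rewrite /dyck_frac -Gseries_walks -sqr_sqrtz /sqrtz /G /of_zt.
by rewrite !(rmorphD, rmorphM, rmorphXn, rmorph1).
Qed.

Lemma sqrtz_neq0 : sqrtz != 0.
Proof.
rewrite tofrac_eq0; apply/eqP => /fpsP/(_ 1%N) /eqP.
by rewrite /= oner_eq0.
Qed.

Lemma z_neq0 : z != 0.
Proof. by rewrite -sqr_sqrtz expf_neq0 ?sqrtz_neq0. Qed.

Lemma K2_neq0 : 2 != 0 :> K.
Proof.
rewrite -(rmorph_nat (FracField.tofrac (R := fps (fps rat)))).
rewrite tofrac_eq0; apply/eqP => /fpsP/(_ 0%N)/fpsP/(_ 0%N).
by rewrite mulr2n !fps_coefD.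
Qed.

Lemma G1_dyck_frac0 : G 1 = dyck_frac 0 * (1 + z * G 1).
Proof.
apply: (mulfI z_neq0); apply: (addrI (1 : K)).
by rewrite -dyck_fracE {1}dyck_fracS mulrA.
Qed.

Lemma G_succ n : G n.+2 * (1 - z * (1 + z * G n.+1)) = 1 + z * G n.+1.
Proof.
by apply: next_level_solved z_neq0 _; rewrite -!dyck_fracE -dyck_fracS.
Qed.

Theorem corollary9 :
  G 1 = (1 + z * C ^+ 2) / (1 - t * z - t * z ^+ 2 * C ^+ 2)
  /\
  forall n : nat, (2 <= n)%N ->
    G n = (G 1 * z * U (n%:Z - 4) (1 / (2 * sqrtz))
             - U (n%:Z - 2) (1 / (2 * sqrtz)))
          / (G 1 * z ^+ 2 * U (n%:Z - 2) (1 / (2 * sqrtz))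
             - z * U n%:Z (1 / (2 * sqrtz))).
Proof.
split; first exact: first_level_solved dyck_frac0 G1_dyck_frac0 C_eq.
case=> // n _; have := homographic_solved sqrtz_neq0 K2_neq0 sqr_sqrtz G_succ n.
exact.
Qed.
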